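(* Let $K$ be an infinite compact Hausdorff space (or, more generally, an infinite normal Hausdorff space). Then $K$ carries a JN-sequence if and only if there exists a countable discrete subset $D$ of $K$ such that the closure $\overline{D}^K$ of $D$ in $K$ (with the subspace topology) carries a disjointly supported JN-sequence $\langle\mu_n\colon n\in\omega\rangle$ with $\operatorname{supp}(\mu_n)\subseteq D$ for every $n\in\omega$.
   Context: All spaces are Tychonoff (in particular Hausdorff). $C(X)$ is the set of all continuous functions $X\to\mathbb{R}$. A finitely supported (signed Borel) measure on $X$ is a finite linear combination $\mu=\sum_{x\in F}\alpha_x\delta_x$ of one-point (Dirac) measures, with $F\subseteq X$ finite and $\alpha_x\in\mathbb{R}\setminus\{0\}$ for $x\in F$; its support is $\operatorname{supp}(\mu)=F$, its norm is $\|\mu\|=\sum_{x\in F}|\alpha_x|$, and $\mu(f)=\int_X f\,d\mu=\sum_{x\in F}\alpha_xf(x)$. A JN-sequence on a space $X$ is a sequence $\langle\mu_n\colon n\in\omega\rangle$ of finitely supported signed measures on $X$ such that $\|\mu_n\|=1$ for every $n\in\omega$ and $\lim_{n\to\infty}\mu_n(f)=0$ for every $f\in C(X)$. It is disjointly supported if $\operatorname{supp}(\mu_n)\cap\operatorname{supp}(\mu_{n'})=\emptyset$ for all $n\ne n'$. A subset $D\subseteq K$ is discrete if it is discrete in the subspace topology. *)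

(* Defs.v *)
From mathcomp Require Export all_boot all_order all_algebra.
From mathcomp Require Export finmap.
From mathcomp Require Export mathcomp_extra boolp classical_sets functions cardinality.
From mathcomp Require Export reals topology normedtype sequences.
Export numFieldNormedType.Exports.

Set Implicit Arguments.
Unset Strict Implicit.
Unset Printing Implicit Defensive.

Import Order.TTheory GRing.Theory Num.Theory.
Local Open Scope classical_set_scope.
Local Open Scope ring_scope.

(* The measure \sum_(x in F) alpha_x delta_x (all alpha_x nonzero) is encoded by
   its coefficient function x |-> alpha_x, which vanishes off F; its support F is
   then [finsupp mu].  In a Hausdorff space the measure determines F and alpha. *)
Definition fsmeasure (R : realType) (X : choiceType) : Type :=
  {fsfun X -> R with 0}.

Definition supp (R : realType) (X : choiceType) (mu : fsmeasure R X) : set X :=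
  [set` finsupp mu].

Definition fsnorm (R : realType) (X : choiceType) (mu : fsmeasure R X) : R :=
  \sum_(x <- finsupp mu) `|mu x|.

Definition fsint (R : realType) (X : choiceType) (mu : fsmeasure R X)
    (f : X -> R) : R :=
  \sum_(x <- finsupp mu) mu x * f x.

Definition JN_sequence (R : realType) (X : topologicalType)
    (mu : nat -> fsmeasure R X) : Prop :=
  (forall n, fsnorm (mu n) = 1) /\
  (forall f : X -> R, continuous f -> fsint (mu n) f @[n --> \oo] --> (0 : R)).

Definition disjointly_supported (R : realType) (X : choiceType)
    (mu : nat -> fsmeasure R X) : Prop :=
  forall m n, m != n -> supp (mu m) `&` supp (mu n) = set0.

(* The topology on the type [D : Type] is the subspace topology. *)
Definition discrete_subset (X : topologicalType) (D : set X) : Prop :=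
  forall A : set D, open A.

(* Main.v *)
Require Import Defs.
From mathcomp Require Import numfun ring lra.
Local Open Scope classical_set_scope.
Local Open Scope ring_scope.

Set Implicit Arguments.
Unset Strict Implicit.
Unset Printing Implicit Defensive.

Import Order.TTheory GRing.Theory Num.Theory.

(* Let [mu] be a JN-sequence on [K].
   - Every continuous [f : K -> R] is bounded on the union of the supports: a
     gliding hump along the values of [|f|] would otherwise produce a continuous
     [g] with [mu_n(g) = 1] for infinitely many [n].
   - By pigeonhole there are, beyond any index, [m] and [n] such that [mu_m] and
     [mu_n] almost agree on a given finite set; yet [mu_m - mu_n] has norm at
     least 1/2, since [mu_m] is detected by a function that almost kills [mu_n].
     Restricting such differences off the earlier supports yields [nu_n],
     pairwise disjointly supported, with norms in [1/4, 2], converging to 0.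
   - Some support has a neighbourhood of arbitrarily small mass for infinitely
     many of the later [nu_m]. Iterating, and multiplying [nu_{n_k}] by
     [(1 - th_0) ... (1 - th_{k-1})], where [th_j = 1] near the [j]-th chosen
     support and [|nu_{n_k}|(th_j)] is summably small, keeps a positive norm and
     convergence to 0, and makes the union [D] of the supports discrete.
   - By Tietze, continuous functions on the closure of [D] extend to [K]. *)

(** * Finitely supported measures *)

Section Measures.
Variables (R : realType) (X : choiceType).
Implicit Types (mu nu : fsmeasure R X) (f g : X -> R).

Lemma fsint_widen mu (S : {fset X}) f :
  (finsupp mu `<=` S)%fset -> fsint mu f = \sum_(x <- S) mu x * f x.
Proof.
by move=> muS; apply: big_fset_incl => // x _ /fsfun_dflt ->; rewrite mul0r.
Qed.

Lemma fsnorm_widen mu (S : {fset X}) :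
  (finsupp mu `<=` S)%fset -> fsnorm mu = \sum_(x <- S) `|mu x|.
Proof.
by move=> muS; apply: big_fset_incl => // x _ /fsfun_dflt ->; rewrite normr0.
Qed.

Lemma fsnorm_ge0 mu : 0 <= fsnorm mu.
Proof. by apply: sumr_ge0. Qed.

Lemma fsint_le mu f C : (forall x, x \in finsupp mu -> `|f x| <= C) ->
  `|fsint mu f| <= C * fsnorm mu.
Proof.
move=> fC; apply: (le_trans (ler_norm_sum _ _ _)); rewrite mulr_sumr.
rewrite big_seq [leRHS]big_seq; apply: ler_sum => x /fC fxC.
by rewrite normrM mulrC ler_wpM2r.
Qed.

Lemma eq_fsint mu f g : (forall x, x \in finsupp mu -> f x = g x) ->
  fsint mu f = fsint mu g.
Proof.
by move=> fg; rewrite /fsint big_seq [RHS]big_seq; apply: eq_bigr => x /fg ->.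
Qed.

Lemma fsintD mu f g : fsint mu (fun x => f x + g x) = fsint mu f + fsint mu g.
Proof. by rewrite -big_split; apply: eq_bigr => x _ /=; rewrite mulrDr. Qed.

Lemma fsintZ mu c f : fsint mu (fun x => c * f x) = c * fsint mu f.
Proof. by rewrite mulr_sumr; apply: eq_bigr => x _; rewrite mulrCA. Qed.

Definition fsmul mu g : fsmeasure R X := [fsfun x in finsupp mu => mu x * g x].

Lemma fsmulE mu g x : fsmul mu g x = mu x * g x.
Proof.
by rewrite fsfun_fun; case: ifPn => // /fsfun_dflt ->; rewrite mul0r.
Qed.

Lemma mem_fsmul mu g x :
  (x \in finsupp (fsmul mu g)) = (x \in finsupp mu) && (g x != 0).
Proof. by rewrite !mem_finsupp fsmulE mulf_eq0 negb_or. Qed.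

Lemma finsupp_fsmul mu g : (finsupp (fsmul mu g) `<=` finsupp mu)%fset.
Proof. by apply/fsubsetP => x; rewrite mem_fsmul => /andP[]. Qed.

Lemma fsint_fsmul mu g f : fsint (fsmul mu g) f = fsint mu (fun x => g x * f x).
Proof.
rewrite (fsint_widen _ (finsupp_fsmul mu g)).
by apply: eq_bigr => x _; rewrite fsmulE mulrA.
Qed.

Lemma fsnorm_fsmul mu g :
  fsnorm (fsmul mu g) = \sum_(x <- finsupp mu) `|mu x| * `|g x|.
Proof.
rewrite (fsnorm_widen (finsupp_fsmul mu g)).
by apply: eq_bigr => x _; rewrite fsmulE normrM.
Qed.

Lemma fsnorm_fsmul_le mu g C : (forall x, x \in finsupp mu -> `|g x| <= C) ->
  fsnorm (fsmul mu g) <= C * fsnorm mu.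
Proof.
move=> gC; rewrite fsnorm_fsmul mulr_sumr big_seq [leRHS]big_seq.
by apply: ler_sum => x /gC gxC; rewrite mulrC ler_wpM2r.
Qed.

Definition fssub mu nu : fsmeasure R X :=
  [fsfun x in (finsupp mu `|` finsupp nu)%fset => mu x - nu x].

Lemma fssubE mu nu x : fssub mu nu x = mu x - nu x.
Proof.
rewrite fsfun_fun in_fsetU; case: ifPn => //; rewrite negb_or => /andP[].
by move=> /fsfun_dflt -> /fsfun_dflt ->; rewrite subrr.
Qed.

Lemma finsupp_fssub mu nu :
  (finsupp (fssub mu nu) `<=` finsupp mu `|` finsupp nu)%fset.
Proof.
apply/fsubsetP => x; apply: contraLR; rewrite in_fsetU negb_or => /andP[mx nx].
by rewrite memNfinsupp fssubE !fsfun_dflt // subrr.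
Qed.

Lemma fsint_fssub mu nu f : fsint (fssub mu nu) f = fsint mu f - fsint nu f.
Proof.
rewrite (fsint_widen _ (finsupp_fssub mu nu)).
rewrite (fsint_widen _ (fsubsetUl (finsupp mu) (finsupp nu))).
rewrite (fsint_widen _ (fsubsetUr (finsupp mu) (finsupp nu))) -sumrB.
by apply: eq_bigr => x _; rewrite fssubE mulrBl.
Qed.

Lemma fsnorm_fssub_le mu nu : fsnorm (fssub mu nu) <= fsnorm mu + fsnorm nu.
Proof.
rewrite (fsnorm_widen (finsupp_fssub mu nu)).
rewrite (fsnorm_widen (fsubsetUl (finsupp mu) (finsupp nu))).
rewrite (fsnorm_widen (fsubsetUr (finsupp mu) (finsupp nu))) -big_split /=.
by apply: ler_sum => x _; rewrite fssubE ler_normB.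
Qed.

End Measures.

Lemma cvg0_seqP (R : realType) (u : nat -> R) :
  u n @[n --> \oo] --> (0 : R) <->
  forall e, 0 < e -> exists N, forall n, (N <= n)%N -> `|u n| < e.
Proof.
split=> [/cvgr0Pnorm_lt u0 e /u0 [N _ HN]|h].
  by exists N => n /HN.
apply/cvgr0Pnorm_lt => e /h[N HN]; exists N => // n; exact: HN.
Qed.

(** * Continuous real functions: interpolation and extension *)

Section Functions.
Variables (R : realType) (T : topologicalType).
Implicit Types f g : T -> R.

Lemma cts_cst (c : R) : continuous (fun _ : T => c).
Proof. move=> x; exact: cvg_cst. Qed.

Lemma ctsD f g : continuous f -> continuous g ->
  continuous (fun x => f x + g x).
Proof. by move=> cf cg x; apply: cvgD; [exact: cf|exact: cg]. Qed.

Lemma ctsM f g : continuous f -> continuous g ->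
  continuous (fun x => f x * g x).
Proof. by move=> cf cg x; apply: cvgM; [exact: cf|exact: cg]. Qed.

Lemma cts_norm f : continuous f -> continuous (fun x => `|f x|).
Proof. by move=> cf x; apply: cvg_norm; exact: cf. Qed.

Lemma cts_max f g : continuous f -> continuous g ->
  continuous (fun x => Num.max (f x) (g x)).
Proof. by move=> cf cg x; apply: continuous_max; [exact: cf|exact: cg]. Qed.

Lemma cts_min f g : continuous f -> continuous g ->
  continuous (fun x => Num.min (f x) (g x)).
Proof. by move=> cf cg x; apply: continuous_min; [exact: cf|exact: cg]. Qed.

(** Induction on [s]: a Urysohn function that is 0 on the earlier points and 1 at [a] corrects the
    value at [a] alone. *)
Lemma interpolation (s : seq T) (v : T -> R) :
  hausdorff_space T -> normal_space T ->
  exists2 h : T -> R, continuous h & forall x, x \in s -> h x = v x.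
Proof.
move=> T2 T4; have T1 := hausdorff_accessible T2.
elim: s => [|a s [h ch hv]]; first by exists (fun=> 0) => //; exact: cts_cst.
have [as_|nas] := boolP (a \in s).
  by exists h => // x; rewrite inE => /predU1P[->|]; exact: hv.
have [||||u [cu u0 u1 _]] := @urysohn_ext_itv T R T4 [set` s] [set a] 0 1.
  - by move/accessible_finite_set_closed : T1; apply; exact: finite_seq.
  - exact: accessible_closed_set1.
- by rewrite -subset0 => x [/= xs xa]; rewrite -xa xs in nas.
  - exact: ltr01.
exists (fun x => h x + (v a - h a) * u x).
  by apply: ctsD => //; apply: ctsM => //; exact: cts_cst.
move=> x; rewrite inE => /predU1P[->|xs].
  have -> : u a = 1 by apply: u1; exists a.
  by rewrite mulr1 subrKC.
have -> : u x = 0 by apply: u0; exists x.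
by rewrite mulr0 addr0 hv.
Qed.

(** The bounded Tietze theorem applies to [p \o f], where [p] maps the line homeomorphically onto
    (-1, 1). *)
Lemma tietze_unbounded (A : set T) (f : T -> R) :
  normal_space T -> closed A -> {within A, continuous f} ->
  exists2 g : T -> R, continuous g & {in A, f =1 g}.
Proof.
move=> T4 clA cf; pose p (t : R) := t / (1 + `|t|).
have d0 (t : R) : 0 < 1 + `|t| by rewrite ltr_pwDl.
have pN t : `|p t| = 1 - (1 + `|t|)^-1.
  rewrite normrM normfV (gtr0_norm (d0 t)); by field; exact/lt0r_neq0/d0.
have p1 t : `|p t| < 1 by rewrite pN ltrBlDr ltrDl invr_gt0.
have cp : continuous p.
  move=> t; apply: cvgM; first exact: cvg_id.
  apply: cvgV; first exact: lt0r_neq0.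
  by apply: cvgD; [exact: cvg_cst|exact: norm_continuous].
have cpf : {within A, continuous (p \o f)}.
  by apply: within_continuous_comp => // x _; exact: cp.
have [F [FE cF F1]] := continuous_bounded_extension T4 clA ltr01 cpf
  (fun x _ => ltW (p1 (f x))).
(* [F] may reach absolute value 1 off [A]; the factor [u] brings it back into (-1, 1), where [p] has
   the inverse s / (1 - |s|). *)
have [||||u [cu u0 u1 u01]] :=
    @urysohn_ext_itv T R T4 [set x | 1 <= `|F x|] A 0 1.
  - apply: (preimage_closed (f := fun x => `|F x|) (D := [set y : R | 1 <= y])).
      by move=> x _; exact: cts_norm.
    exact: closed_ge.
  - exact: clA.
  - rewrite -subset0 => x [/= + Ax]; rewrite -FE ?inE// leNgt => /negP; apply.
    exact: p1.
  - exact: ltr01.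
have G1 x : 0 < 1 - `|u x * F x|.
  rewrite subr_gt0 normrM.
  have /andP[ux0 ux1] : 0 <= u x <= 1.
    by have := u01 (u x) (imageT u x); rewrite /= in_itv.
  have [Fx|Fx] := leP 1 `|F x|.
    by have -> : u x = 0 by [apply: u0; exists x]; rewrite normr0 mul0r.
  by rewrite ger0_norm // (le_lt_trans _ Fx) // ler_piMl.
exists (fun x => u x * F x / (1 - `|u x * F x|)).
  have cG : continuous (fun x => u x * F x) by exact: ctsM.
  move=> x; apply: cvgM; first exact: cG.
  apply: cvgV; first exact: lt0r_neq0.
  by apply: cvgB; [exact: cvg_cst|apply: cvg_norm; exact: cG].
move=> x Ax; have -> : u x = 1 by apply: u1; exists x => //; rewrite -inE.
rewrite mul1r -FE // /= pN subKr invrK /p -mulrA mulVf ?mulr1 //.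
exact: lt0r_neq0.
Qed.

End Functions.

(** * Disjointification *)

Lemma le_fsnorm (R : realType) (X : choiceType) (mu : fsmeasure R X) x :
  `|mu x| <= fsnorm mu.
Proof.
have [xmu|/fsfun_dflt ->] := boolP (x \in finsupp mu); last first.
  by rewrite normr0 fsnorm_ge0.
by rewrite /fsnorm (bigD1_seq x) //= lerDl sumr_ge0.
Qed.

Lemma fsint_pred1 (R : realType) (X : choiceType) (mu : fsmeasure R X) x :
  fsint mu (fun y => (y == x)%:R) = mu x.
Proof.
have [xmu|xmu] := boolP (x \in finsupp mu); last first.
  rewrite (fsfun_dflt xmu) /fsint big_seq big1 // => y ymu.
  by case: eqP => [yx|]; [rewrite yx (negPf xmu) in ymu|rewrite mulr0].
rewrite /fsint (bigD1_seq x) //= eqxx mulr1 big1 ?addr0 // => y /negPf ->.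
by rewrite mulr0.
Qed.

Lemma fsnorm_fssub_fsint (R : realType) (X : choiceType)
    (mu nu : fsmeasure R X) f :
  (forall x, `|f x| <= 1) -> fsint mu f - fsint nu f <= fsnorm (fssub mu nu).
Proof.
move=> f1; rewrite -fsint_fssub -[leRHS]mul1r (le_trans (ler_norm _)) //.
exact: fsint_le.
Qed.

(** Infinite index sets stand for subsequences: refining a subsequence is then mere inclusion. *)
Definition unbounded (A : set nat) := forall n, exists2 m, (n <= m)%N & A m.

Lemma unbounded_ge A N : unbounded A -> unbounded [set n | A n /\ (N <= n)%N].
Proof.
move=> uA n; have [m + Am] := uA (maxn n N).
by rewrite geq_max => /andP[? ?]; exists m.
Qed.

Lemma unbounded_split (A B : set nat) : unbounded A ->
  unbounded (A `&` B) \/ unbounded (A `\` B).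
Proof.
move=> uA; have [|nAB] := pselect (unbounded (A `&` B)); first by left.
right=> n; move: nAB => /existsNP[N nAB].
have [m + Am] := uA (maxn n N); rewrite geq_max => /andP[nm Nm].
by exists m => //; split => // Bm; apply: nAB; exists m.
Qed.

(** * Pigeonhole along subsequences *)

Section Subsequences.
Variable R : realType.

Lemma small_oscillation (u : nat -> R) (A : set nat) (d : R) :
  (forall n, `|u n| <= 1) -> unbounded A -> 0 < d ->
  exists B, [/\ B `<=` A, unbounded B &
    forall m n, B m -> B n -> `|u m - u n| <= d].
Proof.
move=> u1 + d0.
(* Induction on the number [k] of strips of width [d] above -1: the top strip either contains [u n]
   for infinitely many [n] in [A] or can be discarded. *)
have key k : forall A, unbounded A -> (forall n, A n -> u n <= -1 + k%:R * d) ->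
    exists B, [/\ B `<=` A, unbounded B &
      forall m n, B m -> B n -> `|u m - u n| <= d].
  elim: k => [|k IH] {}A uA Au.
    exists A; split=> // m n /Au um /Au un.
    move: (u1 m) (u1 n); rewrite !ler_norml => /andP[? _] /andP[? _].
    apply/andP; split; lra.
  have [uB|uB] := unbounded_split [set n | -1 + k%:R * d < u n] uA.
    exists (A `&` [set n | -1 + k%:R * d < u n]); split=> // m n.
    move=> [/Au + /= mk] [/Au + /= nk].
    rewrite -natr1 ler_norml => ? ?; apply/andP; split; lra.
  have [n [_ /= /negP]|C [CA uC Cd]] := IH _ uB; first by rewrite -leNgt.
  by exists C; split=> // n /CA[].
move=> uA; apply: (key (Num.bound (2 / d))) => // n _.
have := archi_boundP (divr_ge0 (ler0n R 2) (ltW d0)).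
rewrite ltr_pdivrMr // => ?; have := u1 n; rewrite ler_norml => /andP[_ ?]; lra.
Qed.

Lemma small_oscillation_seq (X : eqType) (u : nat -> X -> R) (E : seq X)
    (A : set nat) (d : R) :
  (forall n x, `|u n x| <= 1) -> unbounded A -> 0 < d ->
  exists B, [/\ B `<=` A, unbounded B &
    forall m n x, B m -> B n -> x \in E -> `|u m x - u n x| <= d].
Proof.
move=> u1 uA d0; elim: E => [|a E [B [BA uB Bd]]]; first by exists A; split.
have [C [CB uC Cd]] := small_oscillation (fun n => u1 n a) uB d0.
exists C; split=> [n /CB/BA//|//|m n x Cm Cn].
rewrite inE => /predU1P[->|].
  exact: Cd.
exact: Bd (CB _ Cm) (CB _ Cn).
Qed.

End Subsequences.

(** * Disjointly supported blocks cut from differences *)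

Section Blocks.
Variables (R : realType) (T : topologicalType).
Hypotheses (T2 : hausdorff_space T) (T4 : normal_space T).
Variable mu : nat -> fsmeasure R T.
Hypothesis mu_cvg0 : forall f : T -> R, continuous f ->
  fsint (mu n) f @[n --> \oo] --> (0 : R).

(** The humps sit at ever higher levels of [|f|], so only finitely many of them meet a region where
    [|f|] is bounded; hence their sum is continuous. *)
Lemma bounded_on_supports (f : T -> R) : continuous f ->
  exists C, forall n x, x \in finsupp (mu n) -> `|f x| <= C.
Proof.
move=> cf; apply: contrapT => nC.
have unb C : exists n x, x \in finsupp (mu n) /\ C < `|f x|.
  apply: contrapT => h; apply: nC; exists C => n x xn; rewrite leNgt.
  by apply/negP => Cx; apply: h; exists n, x.
(* [b n] dominates [|f|] on the first n + 1 supports; the summand [n] makes it tend to infinity. *)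
pose b n := \sum_(i < n.+1) \sum_(x <- finsupp (mu i)) `|f x| + n%:R.
have b_supp m n x : (m <= n)%N -> x \in finsupp (mu m) -> `|f x| <= b n.
  rewrite -ltnS => mn xm; rewrite /b (bigD1 (Ordinal mn)) //=.
  rewrite (bigD1_seq x) //= -!addrA lerDl !addr_ge0 ?sumr_ge0 // => i _.
  exact: sumr_ge0.
have b_mono : {homo b : m n / (m <= n)%N >-> m <= n}.
  apply: homo_leq => [//|? ? ?|n]; first exact: le_trans.
  rewrite /b [X in _ <= X + _]big_ord_recr /= -natr1 -!addrA lerD2l.
  by rewrite addrCA lerDl addr_ge0 ?sumr_ge0.
have b_ge n : n%:R <= b n.
  by rewrite /b lerDr; apply: sumr_ge0 => i _; apply: sumr_ge0.
(* A state holds the last index used and the function built so far; the next state alters the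
   function only where [|f|] exceeds [b] of that index. *)
have step (p : nat * (T -> R)) : exists q : nat * (T -> R),
    [/\ (p.1 < q.1)%N, continuous p.2 -> continuous q.2,
        forall y, `|f y| <= b p.1 -> q.2 y = p.2 y & fsint (mu q.1) q.2 = 1].
  case: p => n G /=; have [m [x [xm fx]]] := unb (b n + 1).
  have [h ch hE] :=
    interpolation (finsupp (mu m)) (fun y => (y == x)%:R : R) T2 T4.
  (* [c] is 0 where [|f| <= b n] and 1 at [x], [h] singles out [x] within the support, and [t] tunes
     the integral to 1. *)
  pose c y := Num.max 0 (Num.min 1 (`|f y| - b n)).
  pose t := (1 - fsint (mu m) G) / mu m x.
  exists (m, fun y => G y + t * (c y * h y)); split=> /=.
  - rewrite ltnNge; apply/negP => /b_supp/(_ xm); lra.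
  - move=> cG; apply: ctsD => //; apply: ctsM; first exact: cts_cst.
    apply: ctsM => //; apply: cts_max; first exact: cts_cst.
    apply: cts_min; first exact: cts_cst.
    by apply: ctsD; [exact: cts_norm|exact: cts_cst].
  - move=> y fy; have -> : c y = 0.
      by apply/max_idPl; rewrite ge_min; apply/orP; right; rewrite subr_le0.
    by rewrite mul0r mulr0 addr0.
  - rewrite fsintD fsintZ.
    have -> : fsint (mu m) (fun y => c y * h y) = mu m x.
      rewrite -fsint_pred1; apply: eq_fsint => y ym; rewrite hE //.
      have [->|_] := eqVneq y x; last by rewrite mulr0.
      rewrite mulr1 /c; have -> : Num.min 1 (`|f x| - b n) = 1.
        by apply/min_idPl; lra.
      by apply/max_idPr.
    rewrite divfK ?subrKC // -mem_finsupp //.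
have [nxt nxtP] := choice step.
pose s k := iter k nxt (0%N, fun=> 0).
have s_lt k : ((s k).1 < (s k.+1).1)%N by case: (nxtP (s k)).
have s_mono : {homo (fun k => (s k).1) : m n / (m <= n)%N}.
  by apply: homo_leq => [//|? ? ?|n]; [exact: leq_trans|exact: ltnW].
have s_ge k : (k <= (s k).1)%N.
  by elim: k => // k IH; exact: leq_ltn_trans IH (s_lt k).
have s_cts k : continuous (s k).2.
  elim: k => [|k IH]; first exact: cts_cst.
  by case: (nxtP (s k)) => _ + _ _; apply.
have s_stable k j y : (k <= j)%N -> `|f y| <= b (s k).1 ->
    (s j).2 y = (s k).2 y.
  move=> kj fy; rewrite -(subnK kj); elim: (j - k)%N => // i IH.
  rewrite -IH addSn; case: (nxtP (s (i + k))) => _ _ + _; apply.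
  by rewrite (le_trans fy) // b_mono // s_mono // leq_addl.
have N_le y : `|f y| <= b (s (Num.bound `|f y|)).1.
  rewrite (le_trans (ltW (archi_boundP (normr_ge0 _)))) //.
  by rewrite (le_trans (b_ge _)) // b_mono.
(* By [s_stable] and [N_le] the stages no longer change at [y] from this index on, so [g] is their
   pointwise limit. *)
pose g y := (s (Num.bound `|f y|)).2 y.
have gE k y : `|f y| <= b (s k).1 -> g y = (s k).2 y.
  move=> fy; rewrite /g; have [kN|/ltnW Nk] := leqP k (Num.bound `|f y|).
    exact: s_stable.
  by apply/esym/s_stable.
have cg : continuous g.
  move=> y; set N := Num.bound `|f y|.
  rewrite /continuous_at /g -/N.
  apply: cvg_trans (s_cts N y); apply: near_eq_cvg.
  have : \forall z \near y, `|f z| < N%:R.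
    apply: (cvgr_lt `|f y|); first exact: cts_norm.
    exact: archi_boundP.
  apply: filterS => z /ltW zN; apply/esym/gE; rewrite (le_trans zN) //.
  by rewrite (le_trans (b_ge _)) // b_mono.
(* The successor is needed because stage 0 has no prescribed integral. *)
have [N /(_ (s N.+1).1)] := (cvg0_seqP _).1 (mu_cvg0 cg) 1 ltr01.
rewrite (leq_trans (leqnSn N) (s_ge N.+1)) => /(_ isT).
have -> : fsint (mu (s N.+1).1) g = fsint (mu (s N.+1).1) (s N.+1).2.
  by apply: eq_fsint => x xs; apply: gE; exact: b_supp xs.
by case: (nxtP (s N)) => _ _ _ ->; rewrite normr1 ltxx.
Qed.

Hypothesis mu_norm1 : forall n, fsnorm (mu n) = 1.

(** A continuous function into [-1, 1] that equals the sign of [mu m] on its support has integral 1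
    against [mu m], while its integrals against later measures tend to 0. *)
Lemma norm_separated (A : set nat) N : unbounded A ->
  exists m n, [/\ A m, A n, (N <= m)%N, (N <= n)%N &
    1 / 2 <= fsnorm (fssub (mu m) (mu n))].
Proof.
move=> uA; have [m Nm Am] := uA N.
have [h ch hE] :=
  interpolation (finsupp (mu m)) (fun x => Num.sg (mu m x)) T2 T4.
pose f x := Num.max (-1) (Num.min 1 (h x)).
have cf : continuous f.
  apply: cts_max; first exact: cts_cst.
  by apply: cts_min => //; exact: cts_cst.
have f1 x : `|f x| <= 1.
  by rewrite ler_norml le_max lexx /= ge_max ge_min lexx andbT; lra.
have mf : fsint (mu m) f = 1.
  rewrite -(mu_norm1 m); apply: eq_big_seq => x xm; rewrite /f hE //.
  have -> : Num.max (-1) (Num.min 1 (Num.sg (mu m x))) = Num.sg (mu m x).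
    case: sgrP => _; rewrite ?(min_idPr _) ?(max_idPr _) //; lra.
  by rewrite normrEsg mulrC.
have [N' HN'] := (cvg0_seqP _).1 (mu_cvg0 cf) (1 / 2) ltac:(lra).
have [n + An] := uA (maxn N N'); rewrite geq_max => /andP[Nn /HN'].
rewrite ltr_norml => /andP[_ fn]; exists m, n; split=> //.
apply: le_trans (fsnorm_fssub_fsint (mu m) (mu n) f1); rewrite mf; lra.
Qed.

(** [f] and [C] are quantified after [m] and [n], so one block serves all test functions; [C * d]
    pays for the part of the difference discarded on [E]. *)
Lemma block_exists (E : {fset T}) N (d : R) : 0 < d ->
  exists nu : fsmeasure R T, [/\ [disjoint finsupp nu & E]%fset,
    1 / 2 - d <= fsnorm nu <= 2,
    forall x, x \in finsupp nu -> exists n, x \in finsupp (mu n) &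
    exists m n, [/\ (N <= m)%N, (N <= n)%N & forall f C, 0 <= C ->
      (forall k x, x \in finsupp (mu k) -> `|f x| <= C) ->
      `|fsint nu f| <= `|fsint (mu m) f| + `|fsint (mu n) f| + C * d]].
Proof.
(* The mass allowed at each point of [E]; the successor avoids a zero denominator. *)
move=> d0; pose d' := d / (size E).+1%:R.
have d'0 : 0 < d' by rewrite divr_gt0.
have mu1 n x : `|mu n x| <= 1 by rewrite -(mu_norm1 n) le_fsnorm.
have uT : unbounded setT by move=> n; exists n.
have [B [_ uB Bd]] := small_oscillation_seq E mu1 uT d'0.
have [m [n [Bm Bn Nm Nn mn]]] := norm_separated N uB.
set s := fssub (mu m) (mu n).
have s_supp x : x \in finsupp s -> exists n, x \in finsupp (mu n).
  move/(fsubsetP (finsupp_fssub _ _)); rewrite in_fsetU => /orP[|] ?.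
  - by exists m.
  - by exists n.
pose nu := fsmul s (fun x => (x \notin E)%:R).
pose rho := fsmul s (fun x => (x \in E)%:R).
have rho_d : fsnorm rho <= d.
  rewrite (@fsnorm_widen _ _ _ E); last first.
    apply/fsubsetP => x; rewrite mem_fsmul.
    by case: (x \in E); rewrite ?eqxx ?andbF.
  apply: (@le_trans _ _ (\sum_(x <- E) d')).
    rewrite big_seq [leRHS]big_seq; apply: ler_sum => x xE.
    by rewrite fsmulE xE mulr1 fssubE; exact: Bd.
  rewrite big_const_seq count_predT iter_addr_0 -mulr_natr /d' mulrAC.
  by rewrite ler_pdivrMr // ler_wpM2l ?ler_nat // ltW.
have s_norm : fsnorm s = fsnorm nu + fsnorm rho.
  rewrite !fsnorm_fsmul -big_split /=; apply: eq_bigr => x _.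
  by case: (x \in E); rewrite normr0 normr1 mulr0 mulr1 ?addr0 ?add0r.
exists nu; split.
- apply/fdisjointP => x; rewrite mem_fsmul => /andP[_].
  by case: (x \in E); rewrite ?eqxx.
- have := fsnorm_fssub_le (mu m) (mu n); rewrite -/s !mu_norm1 s_norm.
  move: mn; rewrite -/s s_norm; have := fsnorm_ge0 rho => *.
  apply/andP; split; lra.
- by move=> x; rewrite mem_fsmul => /andP[/s_supp].
- exists m, n; split=> // f C C0 fC.
  have -> : fsint nu f = fsint (mu m) f - fsint (mu n) f - fsint rho f.
    rewrite -fsint_fssub -/s !fsint_fsmul -sumrB; apply: eq_bigr => x _.
    by case: (x \in E) => /=; ring.
  rewrite (le_trans (ler_normB _ _)) // lerD ?ler_normB //.
  rewrite (@le_trans _ _ (C * fsnorm rho)) ?ler_wpM2l //.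
  apply: fsint_le => x /(fsubsetP (finsupp_fsmul _ _)) /s_supp[k].
  exact: fC.
Qed.

Lemma block_sequence : exists nu : nat -> fsmeasure R T,
  [/\ forall i j, (i < j)%N -> [disjoint finsupp (nu j) & finsupp (nu i)]%fset,
      forall n, 1 / 4 <= fsnorm (nu n) <= 2,
      forall f : T -> R, continuous f ->
        exists C, forall n x, x \in finsupp (nu n) -> `|f x| <= C &
      forall f : T -> R, continuous f ->
        fsint (nu n) f @[n --> \oo] --> (0 : R)].
Proof.
(* The tolerance 1 / (k + 4) tends to 0 and is at most 1 / 4, which leaves norms of at least 1 / 2 -
   1 / 4. *)
have d0 k : 0 < k.+4%:R^-1 :> R by rewrite invr_gt0.
have [F FP] := choice (fun p : nat * {fset T} => block_exists p.2 p.1 (d0 p.1)).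
(* [E k] collects the supports of the blocks before the [k]-th. *)
pose E := fix E k := if k is k'.+1 then (E k' `|` finsupp (F (k', E k')))%fset
                     else fset0.
pose nu k := F (k, E k).
have EE i j : (i < j)%N -> (finsupp (nu i) `<=` E j)%fset.
  elim: j => // j IH; rewrite ltnS leq_eqVlt => /predU1P[->|/IH ij].
    exact: fsubsetUr.
  exact: fsubset_trans ij (fsubsetUl _ _).
exists nu; split.
- move=> i j /EE ij; have [+ _ _ _] := FP (j, E j).
  exact: fdisjointWr.
- move=> n; have [_ /= /andP[n1 n2] _ _] := FP (n, E n).
  have : n.+4%:R^-1 <= 4^-1 :> R by rewrite lef_pV2 ?posrE // ler_nat.
  move: n1; rewrite /nu; move: (n.+4%:R^-1) => d n1 dn.
  by apply/andP; split=> //; lra.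
- move=> f /bounded_on_supports[C fC]; exists C => n x xn.
  by have [_ _ /(_ x xn)[k] /fC] := FP (n, E n).
- move=> f cf; have [C0 fC0] := bounded_on_supports cf.
  pose C := Num.max 0 C0.
  have C_ge0 : 0 <= C by rewrite le_max lexx.
  have fC k x : x \in finsupp (mu k) -> `|f x| <= C.
    by move=> /fC0 ?; rewrite le_max; apply/orP; right.
  (* The estimate for a block has three terms, each to be made smaller than [e / 3]. *)
  apply/cvg0_seqP => e e0; have e3 : 0 < e / 3 by lra.
  have [N HN] := (cvg0_seqP _).1 (mu_cvg0 cf) _ e3.
  exists (maxn N (Num.bound (C / (e / 3)))) => n.
  rewrite geq_max => /andP[Nn Cn].
  have [_ _ _ [i [j [/= ni nj /(_ f C C_ge0 fC)]]]] := FP (n, E n).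
  have := HN i (leq_trans Nn ni); have := HN j (leq_trans Nn nj).
  suff : C * n.+4%:R^-1 < e / 3 by rewrite /nu; move: (C * _) => ? *; lra.
  rewrite ltr_pdivrMr // mulrC -ltr_pdivrMr //.
  apply: lt_le_trans (archi_boundP (divr_ge0 C_ge0 (ltW e3))) _.
  by rewrite ler_nat (leq_trans Cn) // -addn4 leq_addr.
Qed.

End Blocks.

(** * Discretization *)

Lemma fsnorm_fsmul_mono (R : realType) (X : choiceType) (mu : fsmeasure R X)
    (g h : X -> R) :
  (forall x, `|g x| <= `|h x|) -> fsnorm (fsmul mu g) <= fsnorm (fsmul mu h).
Proof.
by move=> gh; rewrite !fsnorm_fsmul; apply: ler_sum => x _; rewrite ler_wpM2l.
Qed.

Lemma fsnorm_fsmul_sum (R : realType) (X : choiceType) (mu : fsmeasure R X)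
    (I : Type) (s : seq I) (g : I -> X -> R) : (forall i x, 0 <= g i x) ->
  fsnorm (fsmul mu (fun x => \sum_(i <- s) g i x)) =
  \sum_(i <- s) fsnorm (fsmul mu (g i)).
Proof.
move=> g0; under [RHS]eq_bigr => i _ do rewrite fsnorm_fsmul.
rewrite exchange_big fsnorm_fsmul; apply: eq_bigr => x _ /=.
rewrite [X in _ * X]ger0_norm ?sumr_ge0 // mulr_sumr; apply: eq_bigr => i _.
by rewrite [X in _ = _ * X]ger0_norm.
Qed.

(** * Plateau functions on the line *)

Section Plateau.
Variable R : realType.

Definition clip (t : R) := Num.max 0 (Num.min 1 t).

Lemma clip_ge0 t : 0 <= clip t. Proof. by rewrite le_max lexx. Qed.

Lemma clip_le1 t : clip t <= 1. Proof. by rewrite ge_max ler01 ge_min lexx. Qed.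

Lemma clip_mono : {homo clip : s t / s <= t}.
Proof.
move=> s t st; rewrite /clip ge_max !le_max lexx /= !le_min !ge_min !lexx /=.
by rewrite st !orbT.
Qed.

(* [plateau i] is 1 around [i] and vanishes off [(i - 1/2, i + 1/2)]; as a
   difference of values of [clip] it telescopes when summed over [i]. *)
Definition plateau (i : nat) (t : R) :=
  clip (4 * (t - i%:R) + 2) - clip (4 * (t - i%:R) - 1).

Lemma plateau_ge0 i t : 0 <= plateau i t.
Proof. rewrite subr_ge0; apply: clip_mono; lra. Qed.

Lemma plateau1 i t : `|t - i%:R| < 1 / 4 -> plateau i t = 1.
Proof.
rewrite ltr_norml => /andP[h1 h2]; rewrite /plateau /clip.
have -> : Num.min 1 (4 * (t - i%:R) + 2) = 1 by apply/min_idPl; lra.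
have -> : Num.max 0 (Num.min 1 (4 * (t - i%:R) - 1)) = 0.
  by apply/max_idPl; rewrite ge_min; apply/orP; right; lra.
by rewrite subr0; apply/max_idPr.
Qed.

Lemma sum_plateau_le1 r t : \sum_(i < r) plateau i t <= 1.
Proof.
have -> : \sum_(i < r) plateau i t = \sum_(0 <= i < r) plateau i t.
  by rewrite big_mkord.
(* This stronger bound is inductive: adding plateau [r] leaves 1 minus its descending ramp, which
   starts before the rise of the next plateau. *)
suff : \sum_(0 <= i < r) plateau i t <= 1 - clip (4 * (t - r%:R) + 2).
  have := clip_ge0 (4 * (t - r%:R) + 2); lra.
elim: r => [|r IH]; first by rewrite big_nil subr_ge0 clip_le1.
rewrite big_nat_recr //= /plateau.
have : clip (4 * (t - r.+1%:R) + 2) <= clip (4 * (t - r%:R) - 1).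
  apply: clip_mono; rewrite -natr1; lra.
lra.
Qed.

Lemma cts_plateau (T : topologicalType) (h : T -> R) i :
  continuous h -> continuous (fun x => plateau i (h x)).
Proof.
move=> ch.
have cclip (c : R) : continuous (fun x => clip (4 * (h x - i%:R) + c)).
  apply: cts_max; first exact: cts_cst.
  apply: cts_min; first exact: cts_cst.
  apply: ctsD; last exact: cts_cst.
  by apply: ctsM; [exact: cts_cst|apply: ctsD => //; exact: cts_cst].
by move=> x; apply: cvgB; exact: cclip.
Qed.

End Plateau.

(** * Thinning to a discrete union of supports *)

Section Discretization.
Variables (R : realType) (T : topologicalType).
Hypotheses (T2 : hausdorff_space T) (T4 : normal_space T).
Variable nu : nat -> fsmeasure R T.
Hypothesis nu_disj :
  forall i j, (i < j)%N -> [disjoint finsupp (nu j) & finsupp (nu i)]%fset.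
Hypothesis nu_norm : forall n, 1 / 4 <= fsnorm (nu n) <= 2.

(* Otherwise every neighbourhood of every support would carry mass at least [e]
   of almost all [nu m], which is absurd for more than [2 / e] pairwise disjoint
   neighbourhoods since [fsnorm (nu m) <= 2]. *)
Lemma small_neighborhood (A : set nat) (e : R) : unbounded A -> 0 < e ->
  exists n (th : T -> R) (M : set nat), [/\ A n,
    continuous th /\ (forall x, 0 <= th x <= 1),
    forall x, x \in finsupp (nu n) -> \forall y \near x, th y = 1,
    M `<=` A /\ unbounded M &
    forall m, M m -> fsnorm (fsmul (nu m) th) < e].
Proof.
move=> uA e0; apply: contrapT => nP.
(* Otherwise the indices [m] in [A] with mass below [e] would form an admissible [M]. *)
have big n (th : T -> R) : A n -> continuous th -> (forall x, 0 <= th x <= 1) ->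
    (forall x, x \in finsupp (nu n) -> \forall y \near x, th y = 1) ->
    exists N, forall m, A m -> (N <= m)%N -> e <= fsnorm (fsmul (nu m) th).
  move=> An cth th01 th1; apply: contrapT => nN; apply: nP.
  exists n, th, (A `&` [set m | fsnorm (fsmul (nu m) th) < e]); split=> //.
    split=> // N; apply: contrapT => nm; apply: nN; exists N => m Am Nm.
    by rewrite leNgt; apply/negP => me; apply: nm; exists m.
  by move=> m [].
have [a aP] := choice (fun n =>
  let: ex_intro2 m nm Am := uA n in ex_intro _ m (conj nm Am)).
pose n_ := fix n_ i := if i is i'.+1 then a (n_ i').+1 else a 0%N.
have nA i : A (n_ i) by case: i => [|i]; exact: (aP _).2.
have n_lt i j : (i < j)%N -> (n_ i < n_ j)%N.
  by apply: (homo_ltn ltn_trans) => k; exact: (aP (n_ k).+1).1.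
(* With [r > 2 / e], a mass of [e] near each of [r] supports exceeds the norm bound 2. *)
pose r := (Num.bound (2 / e)).+1.
(* By disjointness [v] is [i] on the [i]-th selected support, so [plateau i] of the interpolant [h]
   is 1 near that support. *)
pose v x : R := \sum_(i < r) i%:R * (x \in finsupp (nu (n_ i)))%:R.
pose s := flatten [seq (finsupp (nu (n_ i)) : seq T) | i <- iota 0 r].
have [h ch hv] := interpolation s v T2 T4.
have hE i x : (i < r)%N -> x \in finsupp (nu (n_ i)) -> h x = i%:R.
  move=> ir xi; rewrite hv; last first.
    by apply/flatten_mapP; exists i; rewrite ?mem_iota.
  rewrite /v (bigD1 (Ordinal ir)) //= xi mulr1 big1 ?addr0 // => j ji.
  suff /negPf -> : x \notin finsupp (nu (n_ j)) by rewrite mulr0.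
  have {ji} : (j < i)%N || (i < j)%N.
    by rewrite -neq_ltn; apply: contraNneq ji => ji; apply/eqP/val_inj.
  case/orP => /n_lt/nu_disj/fdisjointP.
  - by apply.
  - by move=> h'; apply/negP => /h'; rewrite xi.
have [N HN] : exists N : nat -> nat, forall i, (i < r)%N -> forall m, A m ->
    (N i <= m)%N -> e <= fsnorm (fsmul (nu m) (fun x => plateau i (h x))).
  suff /choice[N HN] : forall i, exists N, (i < r)%N -> forall m, A m ->
      (N <= m)%N -> e <= fsnorm (fsmul (nu m) (fun x => plateau i (h x))).
    by exists N.
  move=> i; have [ir|ir] := boolP (i < r)%N; last by exists 0%N.
  have [|x|x xi|N HN] := big (n_ i) (fun x => plateau i (h x)) (nA i).
  - exact: cts_plateau.
  - rewrite plateau_ge0 /= /plateau.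
    have := clip_le1 (4 * (h x - i%:R) + 2).
    have := clip_ge0 (4 * (h x - i%:R) - 1); lra.
  - have : \forall y \near x, `|h y - i%:R| < 1 / 4.
      have := (cvgrPdist_lt _ _).1 (ch x) (1 / 4) ltac:(lra).
      by apply: filterS => y; rewrite distrC (hE i x ir xi).
    by apply: filterS => y; exact: plateau1.
  - by exists N => _.
have [m + Am] := uA (\max_(i < r) N i)%N => Nm.
have : \sum_(i < r) e <= fsnorm (nu m).
  rewrite -[leRHS]mul1r; pose g i x := plateau i (h x).
  apply: (le_trans (y := fsnorm (fsmul (nu m) (fun x => \sum_(i < r) g i x)))).
    rewrite fsnorm_fsmul_sum => [|i x]; last exact: plateau_ge0.
    apply: ler_sum => i _; apply: HN => //.
    by apply: leq_trans Nm; exact: (leq_bigmax i).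
  apply: fsnorm_fsmul_le => x _; rewrite ger0_norm ?sum_plateau_le1 //.
  by apply: sumr_ge0 => i _; exact: plateau_ge0.
apply/negP; rewrite -ltNge; have /andP[_ /le_lt_trans] := nu_norm m; apply.
rewrite sumr_const card_ord -[e *+ _]mulr_natl -ltr_pdivrMr // /r.
rewrite (lt_trans (archi_boundP _)) ?ltr_nat //.
by rewrite divr_ge0 // ltW.
Qed.

Hypothesis nu_bounded : forall f : T -> R, continuous f ->
  exists C, forall n x, x \in finsupp (nu n) -> `|f x| <= C.
Hypothesis nu_cvg0 : forall f : T -> R, continuous f ->
  fsint (nu n) f @[n --> \oo] --> (0 : R).

(** Only later supports need a neighbourhood that avoids them: the earlier ones form a finite set.
    Normalization is postponed, so a lower bound on the norms suffices. *)
Lemma discretization : exists la : nat -> fsmeasure R T,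
  [/\ forall n, 1 / 8 <= fsnorm (la n),
      forall n x, x \in finsupp (la n) -> \forall y \near x,
        forall m, (n < m)%N -> y \notin finsupp (la m) &
      forall f : T -> R, continuous f ->
        fsint (la n) f @[n --> \oo] --> (0 : R)].
Proof.
(* These sum to 1 / 8, half of the lower bound on the norms of the [nu n]. *)
pose eps k : R := (2 ^+ k.+4)^-1.
have eps0 k : 0 < eps k by rewrite invr_gt0 exprn_gt0.
have epsS k : eps k = 2 * eps k.+1.
  by rewrite /eps [2 ^+ k.+1.+4]exprS [(2 * _)^-1]invfM mulVKf ?pnatr_eq0.
(* [p] is a stage number with the indices still available; [q] is the chosen index, its function and
   the next set of indices. *)
pose step (p : nat * set nat) (q : nat * (T -> R) * set nat) :=
  unbounded p.2 -> [/\ p.2 q.1.1 /\ (p.1 <= q.1.1)%N,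
    continuous q.1.2 /\ (forall x, 0 <= q.1.2 x <= 1),
    forall x, x \in finsupp (nu q.1.1) -> \forall y \near x, q.1.2 y = 1,
    q.2 `<=` p.2 /\ unbounded q.2 &
    forall m, q.2 m -> fsnorm (fsmul (nu m) q.1.2) < eps p.1].
have /choice[F FP] (p : nat * set nat) : exists q, step p q.
  case: p => k A; have [uA|nA] := pselect (unbounded A); last first.
    (* An arbitrary value: the premise of [step] fails here. *)
    by exists (0%N, fun=> 0, A).
  have [n [th [M [[An kn] cth th1 [MA uM] Mth]]]] :=
    small_neighborhood (unbounded_ge k uA) (eps0 k).
  by exists (n, th, M) => _; split=> //; split=> // m /MA[].
pose A := fix A k := if k is k'.+1 then (F (k', A k')).2 else setT.
have uA k : unbounded (A k).
  elim: k => [n|k IH]; first by exists n.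
  by have [_ _ _ [_]] := FP (k, A k) IH.
have A_anti i j : (i <= j)%N -> A j `<=` A i.
  elim: j => [|j IH]; first by rewrite leqn0 => /eqP->.
  rewrite leq_eqVlt => /predU1P[->//|/IH ij]; apply: subset_trans ij.
  by have [_ _ _ []] := FP (j, A j) (uA j).
pose n_ k := (F (k, A k)).1.1.
pose th k := (F (k, A k)).1.2.
have n_ge k : (k <= n_ k)%N by have [[]] := FP (k, A k) (uA k).
have cth k : continuous (th k) by have [_ []] := FP (k, A k) (uA k).
have th01 k x : 0 <= th k x <= 1.
  by have [_ [_ h] _ _ _] := FP (k, A k) (uA k); exact: h.
have th1 k x : x \in finsupp (nu (n_ k)) -> \forall y \near x, th k y = 1.
  by have [_ _ h _ _] := FP (k, A k) (uA k); exact: h.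
have th_small j k : (j < k)%N -> fsnorm (fsmul (nu (n_ k)) (th j)) < eps j.
  move=> jk; have [_ _ _ _ h] := FP (j, A j) (uA j); apply: h.
  by apply: (A_anti j.+1 k jk); have [[]] := FP (k, A k) (uA k).
(* [P k] vanishes near each of the [k] supports chosen before. *)
pose P k x := \prod_(j < k) (1 - th j x).
have PS k x : P k.+1 x = P k x * (1 - th k x) by rewrite /P big_ord_recr.
have P01 k x : 0 <= P k x <= 1.
  elim: k => [|k IH]; first by rewrite /P big_ord0 ler01 lexx.
  have := th01 k x; rewrite PS; nra.
have cP k : continuous (P k).
  elim: k => [|k IH].
    rewrite (_ : P 0%N = fun=> 1); first exact: cts_cst.
    by apply/funext => x; rewrite /P big_ord0.
  rewrite (_ : P k.+1 = fun x => P k x * (1 - th k x)); last exact/funext/PS.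
  apply: ctsM => //; move=> x; apply: cvgB; [exact: cvg_cst|exact: cth].
have PB m k x : (m <= k)%N -> 0 <= P m x - P k x <= \sum_(m <= j < k) th j x.
  elim: k => [|k IH].
    by rewrite leqn0 => /eqP->; rewrite subrr big_nil lexx.
  rewrite leq_eqVlt ltnS => /predU1P[->|mk].
    by rewrite subrr big_geq ?lexx.
  rewrite big_nat_recr //= PS.
  have := IH mk; have := th01 k x; have := P01 k x; nra.
have sum_eps m k : (m <= k)%N ->
    \sum_(m <= j < k) eps j <= 2 * eps m - 2 * eps k.
  elim: k => [|k IH].
    by rewrite leqn0 => /eqP->; rewrite subrr big_nil lexx.
  rewrite leq_eqVlt ltnS => /predU1P[->|mk].
    by rewrite subrr big_geq ?lexx.
  rewrite big_nat_recr //=; have := IH mk; have := epsS k; lra.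
(* Replacing [P k] by [P m] costs at most [2 * eps m], uniformly in [k]: [m = 0] gives the norm
   bound, large [m] the convergence. *)
have tail m k : (m <= k)%N ->
    fsnorm (fsmul (nu (n_ k)) (fun x => P m x - P k x)) <= 2 * eps m.
  move=> mk.
  apply: (@le_trans _ _ (\sum_(m <= j < k) eps j)); last first.
    by have := sum_eps m k mk; have := eps0 k; lra.
  apply: (@le_trans _ _ (fsnorm (fsmul (nu (n_ k))
      (fun x => \sum_(m <= j < k) th j x)))).
    apply: fsnorm_fsmul_mono => x; have /andP[? ?] := PB m k x mk.
    by rewrite !ger0_norm // (le_trans _ (y := P m x - P k x)).
  rewrite fsnorm_fsmul_sum => [|i x]; last by have /andP[] := th01 i x.
  by apply: ler_sum_nat => j /andP[_ /th_small /ltW].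
exists (fun k => fsmul (nu (n_ k)) (P k)); split.
- move=> k; have := tail 0%N k (leq0n k); have /andP[+ _] := nu_norm (n_ k).
  have : fsnorm (nu (n_ k)) <= fsnorm (fsmul (nu (n_ k)) (P k)) +
      fsnorm (fsmul (nu (n_ k)) (fun x => P 0%N x - P k x)).
    rewrite !fsnorm_fsmul -big_split; apply: ler_sum => x _ /=.
    rewrite -mulrDr -[leLHS]mulr1 ler_wpM2l //.
    by rewrite (le_trans _ (ler_normD _ _)) // subrKC /P big_ord0 normr1.
  have -> : 2 * eps 0%N = 1 / 8 by rewrite /eps; field.
  lra.
- move=> k x; rewrite mem_fsmul => /andP[/th1 + _]; apply: filterS => y y1 m km.
  rewrite mem_fsmul negb_and negbK; apply/orP; right.
  by rewrite /P (bigD1 (Ordinal km)) //= y1 subrr mul0r.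
- move=> f cf; have [C0 fC0] := nu_bounded cf.
  pose C := Num.max 1 C0.
  have C_gt0 : 0 < C by rewrite lt_max ltr01.
  have fC n x : x \in finsupp (nu n) -> `|f x| <= C.
    by move=> /fC0 ?; rewrite le_max; apply/orP; right.
  apply/cvg0_seqP => e e0; have e2 : 0 < e / 2 by lra.
  (* [m] is fixed first, so that [P m] times [f] is a single continuous function to which [nu_cvg0]
     applies. *)
  have [m me] : exists m, C * (2 * eps m) < e / 2.
    exists (Num.bound (C / (e / 2))).
    set k := Num.bound _.
    have kC : C / (e / 2) < k%:R.
      by apply: archi_boundP; rewrite divr_ge0 // ltW.
    have : k%:R < 2 ^+ k.+3 :> R.
      rewrite -natrX ltr_nat (leq_trans (ltn_expl k (ltnSn 1))) //.
      by rewrite leq_exp2l // -addn3 leq_addr.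
    move=> /(lt_trans kC); rewrite ltr_pdivrMr //.
    have -> : C * (2 * eps k) = C / 2 ^+ k.+3.
      by rewrite /eps exprS [(2 * _)^-1]invfM mulVKf ?pnatr_eq0.
    by rewrite ltr_pdivrMr ?exprn_gt0 // mulrC.
  have [N HN] := (cvg0_seqP _).1 (nu_cvg0 (ctsM (cP m) cf)) _ e2.
  exists (maxn N m) => k; rewrite geq_max => /andP[Nk mk].
  have := HN (n_ k) (leq_trans Nk (n_ge k)).
  have : `|fsint (fsmul (nu (n_ k)) (fun x => P m x - P k x)) f| <=
      C * (2 * eps m).
    apply: le_trans (ler_wpM2l (ltW C_gt0) (tail m k mk)).
    apply: fsint_le => x /(fsubsetP (finsupp_fsmul _ _)); exact: fC.
  have -> : fsint (fsmul (nu (n_ k)) (P k)) f =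
      fsint (nu (n_ k)) (fun x => P m x * f x) -
      fsint (fsmul (nu (n_ k)) (fun x => P m x - P k x)) f.
    rewrite !fsint_fsmul -sumrB; apply: eq_bigr => x _; ring.
  move=> h1 h2; apply: le_lt_trans (ler_normB _ _) _; move: me h1 h2.
  move: (C * _) => ?; lra.
Qed.

End Discretization.

(** * Passing to a closed subspace *)

Section Transport.
Variables (R : realType) (X : choiceType) (A : set X).

(** The image measure under the inclusion; the default 0 is never reached, as the listed points lie
    in [A]. *)
Definition push (mu : fsmeasure R A) : fsmeasure R X :=
  [fsfun x in [fset (set_val : A -> X) y | y in finsupp mu]%fset =>
    if insub x is Some y then mu y else 0].

Lemma pushE (mu : fsmeasure R A) (y : A) : push mu (set_val y) = mu y.
Proof.
rewrite fsfun_fun set_valE valK; case: ifPn => // /negP ymu.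
apply/esym/fsfun_dflt/negP => y_in; apply: ymu; exact: in_imfset.
Qed.

Lemma finsupp_push (mu : fsmeasure R A) :
  (finsupp (push mu) `<=` [fset (set_val : A -> X) y | y in finsupp mu])%fset.
Proof.
apply/fsubsetP => x; apply: contraLR => /negPf xmu.
by rewrite memNfinsupp fsfun_fun xmu.
Qed.

Lemma fsint_push (mu : fsmeasure R A) f :
  fsint (push mu) f = fsint mu (f \o set_val).
Proof.
rewrite (fsint_widen _ (finsupp_push mu)) big_imfset /=; last first.
  by move=> y z _ _; exact: val_inj.
by apply: eq_bigr => y _; rewrite pushE.
Qed.

Lemma fsnorm_push (mu : fsmeasure R A) : fsnorm (push mu) = fsnorm mu.
Proof.
rewrite (fsnorm_widen (finsupp_push mu)) big_imfset /=; last first.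
  by move=> y z _ _; exact: val_inj.
by apply: eq_bigr => y _; rewrite pushE.
Qed.

(** Restriction to [A]: support points outside [A] are dropped. *)
Definition pull (nu : fsmeasure R X) : fsmeasure R A :=
  [fsfun y in [fset y in pmap insub (finsupp nu)]%fset => nu (set_val y)].

Lemma pullE (nu : fsmeasure R X) (y : A) : pull nu y = nu (set_val y).
Proof.
rewrite fsfun_fun inE /= mem_pmap_sub; case: ifPn => // /fsfun_dflt.
by rewrite set_valE.
Qed.

Lemma mem_pull (nu : fsmeasure R X) (y : A) :
  (y \in finsupp (pull nu)) = (set_val y \in finsupp nu).
Proof. by rewrite !mem_finsupp pullE. Qed.

Lemma push_pull (nu : fsmeasure R X) :
  (forall x, x \in finsupp nu -> A x) -> push (pull nu) = nu.
Proof.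
move=> nuA; apply/fsfunP => x.
have [Ax|nAx] := pselect (A x).
  by have := pushE (pull nu) (SigSub (mem_set Ax)); rewrite pullE.
rewrite !fsfun_dflt //.
  by apply/negP => /nuA.
apply/negP => /(fsubsetP (finsupp_push _))/imfsetP[y _ xy].
by apply: nAx; rewrite xy; exact: set_valP.
Qed.

End Transport.

(** A continuous function on [A] extends to [K] by Tietze, with the same integrals since the
    measures live on [A]. *)
Lemma JN_sequence_closed_subspace (R : realType) (K : topologicalType)
    (A : set K) (la : nat -> fsmeasure R K) :
  normal_space K -> closed A -> (forall n x, x \in finsupp (la n) -> A x) ->
  JN_sequence la -> JN_sequence (X := A) (fun n => pull A (la n)).
Proof.
move=> K4 clA laA [la1 la0]; split=> [n|f cf].
  by rewrite -fsnorm_push push_pull //; exact: laA.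
(* ['valL_(0 : R) f] is [f] extended by 0; only its values on [A] matter. *)
have [g cg fg] : exists2 g : K -> R,
    continuous g & {in A, 'valL_(0 : R) f =1 g}.
  apply: tietze_unbounded => //.
  by apply/subspace_sigL_continuousP; rewrite valLK.
rewrite (_ : (fun n => _) = fun n => fsint (la n) g); first exact: la0.
apply/funext => n; rewrite -[in RHS](push_pull (laA n)) fsint_push.
apply: eq_fsint => y _ /=; rewrite -fg ?inE; last exact: set_valP.
by rewrite -[in LHS](valLK 0 f).
Qed.

(** * The equivalence for compact or normal spaces *)

Theorem corollary1p3 (R : realType) (K : topologicalType)
    (Kinf : infinite_set [set: K]) (KT2 : hausdorff_space K)
    (Kcn : compact [set: K] \/ normal_space K) :
  (exists mu : nat -> fsmeasure R K, JN_sequence mu) <->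
  (exists D : set K,
    [/\ countable D, discrete_subset D &
        exists mu : nat -> fsmeasure R (closure D),
          [/\ JN_sequence mu, disjointly_supported mu &
              forall n, set_val @` supp (mu n) `<=` D]]).
Proof.
have K4 : normal_space K by case: Kcn => // /compact_normal; apply.
split=> [[mu [mu1 mu0]]|[D [_ _ [mu [[mu1 mu0] _ _]]]]]; last first.
  (* Image measures settle this direction, since continuous functions on [K] restrict to continuous
     ones. *)
  exists (fun n => push (mu n)); split=> [n|f cf]; first by rewrite fsnorm_push.
  rewrite (_ : (fun n => _) = fun n => fsint (mu n) (f \o set_val)).
    apply: mu0 => x; apply: continuous_comp; last exact: cf.
    exact: initial_continuous.
  by apply/funext => n; rewrite fsint_push.
have [nu [nu_disj nu_norm nu_bnd nu0]] := block_sequence KT2 K4 mu0 mu1.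
have [la [la8 la_near la0]] := discretization KT2 K4 nu_disj nu_norm nu_bnd nu0.
have la_gt0 n : 0 < fsnorm (la n) by apply: lt_le_trans (la8 n); lra.
pose D := \bigcup_n [set` finsupp (la n)].
pose c n := (fsnorm (la n))^-1.
pose ka n := fsmul (la n) (fun=> c n).
have ka_supp n x : (x \in finsupp (ka n)) = (x \in finsupp (la n)).
  by rewrite mem_fsmul invr_eq0 gt_eqF ?andbT.
(* [la_near] holds in particular at the point itself, so each support misses all later ones. *)
have la_disj m n x : x \in finsupp (la m) -> x \in finsupp (la n) -> m = n.
  move=> xm xn; case: (ltngtP m n) => // [mn|nm].
  - by have := nbhs_singleton (la_near m x xm) n mn; rewrite xn.
  - by have := nbhs_singleton (la_near n x xn) m nm; rewrite xm.
have kaD n x : x \in finsupp (ka n) -> closure D x.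
  by rewrite ka_supp => xn; apply: subset_closure; exists n.
have JNka : JN_sequence ka.
  split=> [n|f cf].
    rewrite fsnorm_fsmul -mulr_suml ger0_norm ?invr_ge0 ?fsnorm_ge0 //.
    by apply: mulfV; rewrite gt_eqF // la_gt0.
  apply/cvg0_seqP => e e0.
  (* Normalizing multiplies integrals by at most 8. *)
  have [N HN] := (cvg0_seqP _).1 (la0 f cf) (e / 8) ltac:(lra).
  exists N => n /HN fe; rewrite fsint_fsmul fsintZ normrM.
  rewrite ger0_norm ?invr_ge0 ?fsnorm_ge0 // mulrC ltr_pdivrMr //.
  by have := la8 n; have := la_gt0 n; nra.
exists D; split.
- by apply: bigcup_countable => // n _; exact/finite_set_countable/finite_fset.
(* If [x] is in the [k]-th support, [la_near] keeps later supports away; the other points of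
   supports up to [k] form the finite, hence closed, set [B]. *)
- have open1 (x : D) : open [set x].
    have [k _ xk] := set_valP x.
    pose B := (\bigcup_(m in `I_k.+1) [set` finsupp (la m)]) `\ set_val x.
    have clB : closed B.
      move/hausdorff_accessible/accessible_finite_set_closed : KT2; apply.
      apply: finite_setD; apply: bigcup_finite => [|m _].
      - exact: finite_II.
      - exact: finite_fset.
    have nB : \forall y \near (set_val x : K), ~ B y.
      by apply: open_nbhs_nbhs; split; [exact: closed_openC|move=> [_]; exact].
    rewrite openE => _ ->; rewrite /interior /=.
    have : \forall y \near x, ~ B (set_val y) /\
        forall m, (k < m)%N -> set_val y \notin finsupp (la m).
      exact: (@initial_continuous D K set_val x _
        (filterI nB (la_near k _ xk))).
    apply: filterS => y [/= nBy yk]; have [m _ ym] := set_valP y.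
    apply: contrapT => yx; apply: nBy; split; last by move=> /val_inj.
    exists m => //=; rewrite ltnS leqNgt; apply/negP => km.
    by move/negP: (yk m km); apply.
  by move=> S; rewrite -(image_id S) -bigcup_imset1; apply: bigcup_open => ? _.
- exists (fun n => pull (closure D) (ka n)); split.
  + exact: JN_sequence_closed_subspace K4 (@closed_closure _ D) kaD JNka.
  + move=> m n /eqP mn; rewrite -subset0 => y [].
    rewrite /supp /= !mem_pull !ka_supp => ym yn.
    exact/mn/(la_disj _ _ _ ym yn).
  + move=> n _ [y /= + <-]; rewrite /supp /= mem_pull ka_supp => yn.
    by exists n.
Qed.
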